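(* Let $n,m\in\mathbb N$ and consider a robotic system on the configuration space $\mathcal Q=\mathbb R^n$ with data $D,\Gamma,U,F_{\mathrm{ext}},B$ (as described in the context) and associated control affine map $$F(x,u)=\begin{bmatrix}\dot q\\ D(q)^{-1}\big(F_{\mathrm{ext}}(q,\dot q)-\Gamma(q,\dot q)\dot q-\nabla U(q)\big)\end{bmatrix}+\begin{bmatrix}0_{n\times m}\\ D(q)^{-1}B(q)\end{bmatrix}u,\qquad x=(q,\dot q)\in\mathbb R^n\times\mathbb R^n,\ u\in\mathbb R^m .$$ Assume that: (i) $D,\Gamma,\nabla U,F_{\mathrm{ext}},B$ are each locally Lipschitz continuous; (ii) there is $\lambda_{\min}>0$ with $\lambda_{\min}I_n\preceq D(q)$ for all $q\in\mathbb R^n$; (iii) there is a nonempty closed set $G\subseteq\mathbb R^m$ such that for every $u\in G$ there are constants $c_0\ge 0$ and $c_1>0$ with $$\|F_{\mathrm{ext}}(q,\dot q)-\nabla U(q)+B(q)u\|_2\le c_0+c_1\|\dot q\|_2\quad\text{for all }q,\dot q\in\mathbb R^n .$$ Then for every $x\in\mathbb R^{2n}$ and $u\in G$, the maximal solution of $\dot\phi(t)=F(\phi(t),u)$, $\phi(0)=x$, is defined for all $t\ge 0$. Consequently, for every sample period $h>0$: the drift vector field $F(\cdot,0)$ and the control vector fields (the columns of $\begin{bmatrix}0_{n\times m}\\ D(q)^{-1}B(q)\end{bmatrix}$) are locally Lipschitz continuous, and there exist nonempty subsets $\mathcal S\subseteq\mathcal S_h$ and $\mathcal A\subseteq\mathbb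 R^m$ and a correspondence $C:\mathcal S\to\mathcal P(\mathcal A)$ such that - $\emptyset\ne C(x)\subseteq C_h(x)$ for every $x\in\mathcal S$; - $\mathrm{Graph}(C)=\{(x,u):x\in\mathcal S,\ u\in C(x)\}$ is a closed subset of $\mathcal S\times\mathcal A$; - $f_h(\mathrm{Graph}(C))\subseteq\mathcal S$.
   Context: Robotic system data: the inertia matrix function $D:\mathbb R^n\to\mathbb S^n_{++}$ (symmetric positive definite $n\times n$ matrices) is differentiable; the Coriolis/centrifugal matrix function $\Gamma:\mathbb R^n\times\mathbb R^n\to\mathbb R^{n\times n}$ is $$(\Gamma(q,\dot q))_{ij}=\sum_{k=1}^n\Big(\frac{\partial}{\partial q_j}(D(q))_{ik}-\frac12\frac{\partial}{\partial q_i}(D(q))_{jk}\Big)\dot q_k ;$$ the potential energy $U:\mathbb R^n\to\mathbb R$ is differentiable; $F_{\mathrm{ext}}:\mathbb R^n\times\mathbb R^n\to\mathbb R^n$ gives external nonconservative forces; $B:\mathbb R^n\to\mathbb R^{n\times m}$ is the actuation matrix function. Here $\dot q$ denotes an independent velocity variable in $\mathbb R^n$. Time sampling: for $x\in\mathbb R^{2n}$, a constant input $u\in\mathbb R^m$ and an open interval $I\ni 0$, a solution of the initial value problem is a differentiable $\phi:I\to\mathbb R^{2n}$ with $\phi(0)=x$ and $\dot\phi(t)=F(\phi(t),u)$ for all $t\in I$. For $h>0$, $C_h(x)$ is the set of all $u\in\mathbb R^m$ for which there is an open interval $I$ with $[0,h]\subset I$ on which this initial value problem has a unique solution, denoted $\phi_{x,u}$;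 $\mathcal S_h$ is the set of all $x\in\mathbb R^{2n}$ with $C_h(x)\neq\emptyset$. For $x\in\mathcal S_h$ and $u\in C_h(x)$, $f_h(x,u)=\phi_{x,u}(h)$. *)

(* Defs.v *)
From HB Require Import structures.
From mathcomp Require Import all_boot all_order all_algebra.
From mathcomp Require Import all_classical all_reals all_analysis.

Set Implicit Arguments.
Unset Strict Implicit.
Unset Printing Implicit Defensive.

Import Order.TTheory GRing.Theory Num.Theory.
Import numFieldNormedType.Exports.

Local Open Scope classical_set_scope.
Local Open Scope ring_scope.

(* MathComp-Analysis, over an arbitrary [R : realType].  Vectors of R^k are
   columns ['cV[R]_k]; a state x = (q, qdot) in R^(2n) is a column of height
   [n + n], with [q = usubmx x] and [qdot = dsubmx x]. *)

Section LinearAlgebra.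
Context {R : realType}.

(* The library norm on matrices is the sup norm. *)
Definition norm2 n (v : 'cV[R]_n) : R := Num.sqrt (\sum_i v i 0 ^+ 2).

Definition quad_form n (M : 'M[R]_n) (v : 'cV[R]_n) : R :=
  (v^T *m M *m v) 0 0.

Definition pos_def n (M : 'M[R]_n) : Prop :=
  M^T = M /\ forall v : 'cV[R]_n, v != 0 -> 0 < quad_form M v.

Definition pos_semidef n (M : 'M[R]_n) : Prop :=
  M^T = M /\ forall v : 'cV[R]_n, 0 <= quad_form M v.

Definition loewner_le n (M N : 'M[R]_n) : Prop := pos_semidef (N - M).

End LinearAlgebra.

Section Calculus.
Context {R : realType}.

Definition locally_lipschitz (V W : normedModType R) (f : V -> W) : Prop :=
  forall x : V, exists2 A : set V, nbhs x A & [lipschitz f y | y in A].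

Definition partial n (W : normedModType R) (j : 'I_n) (f : 'cV[R]_n -> W)
    (q : 'cV[R]_n) : W :=
  'D_(delta_mx j 0) f q.

Definition gradient n (U : 'cV[R]_n -> R) (q : 'cV[R]_n) : 'cV[R]_n :=
  \col_i partial i U q.

End Calculus.

Section RoboticSystem.
Context {R : realType} {n m : nat}.
Variables (D : 'cV[R]_n -> 'M[R]_n) (U : 'cV[R]_n -> R)
  (Fext : 'cV[R]_n -> 'cV[R]_n -> 'cV[R]_n) (B : 'cV[R]_n -> 'M[R]_(n, m)).

Definition coriolis (q qdot : 'cV[R]_n) : 'M[R]_n :=
  \matrix_(i, j) \sum_k
    (partial j (fun p => D p i k) q
     - 2^-1 * partial i (fun p => D p j k) q) * qdot k 0.

Definition drift_field (x : 'cV[R]_(n + n)) : 'cV[R]_(n + n) :=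
  let q := usubmx x in let qdot := dsubmx x in
  col_mx qdot
    (invmx (D q) *m (Fext q qdot - coriolis q qdot *m qdot - gradient U q)).

Definition control_matrix (x : 'cV[R]_(n + n)) : 'M[R]_(n + n, m) :=
  let q := usubmx x in col_mx 0 (invmx (D q) *m B q).

Definition robot_map (x : 'cV[R]_(n + n)) (u : 'cV[R]_m) : 'cV[R]_(n + n) :=
  drift_field x + control_matrix x *m u.

End RoboticSystem.

Section TimeSampling.
Context {R : realType} {N m : nat}.
Variable F : 'cV[R]_N -> 'cV[R]_m -> 'cV[R]_N.

(* Open intervals, possibly unbounded, containing the initial time 0. *)
Definition time_interval (I : set R) : Prop :=
  [/\ is_interval I, open I & I 0].

(* A solution I -> R^N is represented by a total function on R of which only
   the values on I are constrained: since I is open, differentiability at a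
   point of I does not depend on the values outside I. *)
Definition is_solution (x : 'cV[R]_N) (u : 'cV[R]_m) (I : set R)
    (phi : R -> 'cV[R]_N) : Prop :=
  phi 0 = x /\ forall t : R, I t -> is_derive t (1 : R) phi (F (phi t) u).

Definition is_unique_solution (x : 'cV[R]_N) (u : 'cV[R]_m) (I : set R)
    (phi : R -> 'cV[R]_N) : Prop :=
  is_solution x u I phi /\
  forall psi, is_solution x u I psi -> forall t, I t -> psi t = phi t.

(* A solution that no solution on a strictly larger interval extends. *)
Definition is_maximal_solution (x : 'cV[R]_N) (u : 'cV[R]_m) (I : set R)
    (phi : R -> 'cV[R]_N) : Prop :=
  [/\ time_interval I, is_solution x u I phi &
    forall J psi, time_interval J -> is_solution x u J psi ->
      I `<=` J -> (forall t, I t -> psi t = phi t) -> J = I].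

Definition is_sampled_solution (h : R) (x : 'cV[R]_N) (u : 'cV[R]_m)
    (phi : R -> 'cV[R]_N) : Prop :=
  exists I : set R,
    [/\ time_interval I, `[0, h] `<=` I & is_unique_solution x u I phi].

(* C_h(x) *)
Definition sampling_inputs (h : R) (x : 'cV[R]_N) : set 'cV[R]_m :=
  [set u | exists phi, is_sampled_solution h x u phi].

(* S_h *)
Definition sampling_states (h : R) : set 'cV[R]_N :=
  [set x | sampling_inputs h x !=set0].

(* f_h(x, u) = phi_{x,u}(h), meaningful for u in C_h(x).  The value does not
   depend on which interval I, hence which phi, is selected: by gluing at time
   0, solutions unique on two intervals containing [0, h] agree on [0, h]. *)
Definition sampled_map (h : R) (x : 'cV[R]_N) (u : 'cV[R]_m) : 'cV[R]_N :=
  (get [set phi | is_sampled_solution h x u phi] : R -> 'cV[R]_N) h.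

End TimeSampling.

Definition graph {X Y : Type} (S : set X) (C : X -> set Y) : set (X * Y) :=
  [set p | S p.1 /\ C p.1 p.2].

(* Main.v *)
Require Import Defs.
From HB Require Import structures.
From mathcomp Require Import all_boot all_order all_algebra.
From mathcomp Require Import all_classical all_reals all_analysis.
From mathcomp Require Import ring lra.

Set Implicit Arguments.
Unset Strict Implicit.
Unset Printing Implicit Defensive.

Import Order.TTheory GRing.Theory Num.Theory.
Import numFieldNormedType.Exports.

Local Open Scope classical_set_scope.
Local Open Scope ring_scope.

(** For a fixed input the robot field x |-> F(x, u) is locally Lipschitz: its
    entries are sums and products of entries of the data and of the inverse of
    D(q), and by Cramer's rule the latter is a quotient of polynomials in the
    entries of D(q) with nonvanishing denominator.  Hence solutions are unique,
    and the union of all solutions through x is the unique maximal one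
    ([maximal_solution]).  Completeness in forward time comes from an energy
    estimate.  The Coriolis matrix is built so that twice the power
    qdot . Gamma qdot cancels the term qdot . (dD/dt) qdot ([coriolis_power]);
    so along a solution E = qdot . D(q) qdot, twice the kinetic energy,
    satisfies E' = 2 qdot . (Fext - grad U + B u)
    ([kinetic_energy_derive]).  The growth hypothesis and D >= lambda_min bound
    this by a + b E, so by Gronwall's inequality the velocity, and therefore
    the position, stay bounded on bounded time intervals
    ([robot_apriori_bound]).

    An a priori bound on [0, T] yields a solution on a neighbourhood of [0, T]
    without any stepwise continuation ([bounded_solution_exists]): compose the
    field with the clamping of all coordinates to a cube strictly larger than
    the bound.  The new field is globally Lipschitz, so Picard iteration solves
    it on the whole line ([global_lipschitz_solution]), and its solution cannot
    reach the boundary of the cube during [0, T], because before doing so it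
    solves the original equation and obeys the bound.

    Since for inputs in G no solution escapes in positive time, every sample
    period works with S the whole state space, A = G, and C(x) = G for all x. *)

(** * Matrices with the sup norm *)

Section Matrices.
Context {R : realType}.

Lemma mx_norm_leP p q (M : 'M[R]_(p, q)) (a : R) : 0 <= a ->
  `|M| <= a <-> forall i j, `|M i j| <= a.
Proof.
move=> a0; rewrite [`|M|]/Num.Def.normr/= mx_normrE; split.
  move=> /bigmax_leP[_ h] i j; exact: (h (i, j)).
by move=> h; apply/bigmax_leP; split=> // -[i j] _; exact: h.
Qed.

Lemma ler_mx_norm_coord p q (M : 'M[R]_(p, q)) i j : `|M i j| <= `|M|.
Proof. exact: (mx_norm_leP M (normr_ge0 M)).1. Qed.

Lemma cvg_mx p q (T : Type) (F : set_system T) (FF : Filter F) (f : T -> 'M[R]_(p, q))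
    (M : 'M[R]_(p, q)) :
  (forall i j, f x i j @[x --> F] --> M i j) -> f @ F --> M.
Proof.
move=> h; apply/cvgrPdist_le => /= e e0; near=> x.
apply/mx_norm_leP; first exact: ltW.
move=> i j; rewrite !mxE.
move: i j; near: x; apply: filter_forall => i; apply: filter_forall => j.
exact: (cvgrPdist_le _ _).1 (h i j) _ e0.
Unshelve. all: by end_near. Qed.

(** Transposition carries the Heine-Borel property over from row vectors. *)
Lemma compact_norm_le n (r : R) : compact [set v : 'cV[R]_n | `|v| <= r].
Proof.
have [r0|r0] := ltP r 0.
  rewrite (_ : mkset _ = set0); first exact: compact0.
  by rewrite -subset0 => v /= /(le_trans (normr_ge0 v)); rewrite leNgt r0.
have cK : compact [set v : 'rV[R]_n | forall i, `[- r, r]%classic (v ord0 i)].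
  by apply: (@rV_compact _ n (fun=> `[- r, r]%classic)) => i; exact: segment_compact.
rewrite (_ : mkset _ = trmx @` [set v : 'rV[R]_n | forall i, `[- r, r]%classic (v ord0 i)]).
  apply: continuous_compact cK; apply: continuous_subspaceT => v.
  apply: (@cvg_mx _ _ _ (nbhs v) _ trmx v^T) => i j; rewrite mxE.
  under eq_fun do rewrite mxE.
  exact: coord_continuous.
apply/seteqP; split=> [v /= /mx_norm_leP h|_ [w /= h <-]].
  exists v^T; last exact: trmxK.
  by move=> i; rewrite mxE /= in_itv /= -ler_norml; exact: h.
apply/mx_norm_leP => // i j; rewrite mxE ord1 ler_norml.
by have := h i; rewrite in_itv.
Qed.

End Matrices.

(** * Locally Lipschitz maps *)

Section LocallyLipschitz.
Context {R : realType}.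
Implicit Types V W : normedModType R.

Lemma near_fst V W (x : V) (y : W) (P : set V) :
  nbhs x P -> \forall p \near ((x, y) : V * W), P p.1.
Proof. by move=> xP; exists (P, setT) => [|p []//]; split=> //; exact: filterT. Qed.

Lemma near_snd V W (x : V) (y : W) (P : set W) :
  nbhs y P -> \forall p \near ((x, y) : V * W), P p.2.
Proof. by move=> yP; exists (setT, P) => [|p []//]; split=> //; exact: filterT. Qed.

(** Near the diagonal of the product: the constant K is fixed first and pairs of
    points are handled by a single filter, so that the estimates below, and
    compactness arguments on a product, only combine neighbourhoods. *)
Lemma locally_lipschitzP V W (f : V -> W) :
  locally_lipschitz f <-> forall x, exists2 K : R, 0 <= K &
    \forall p \near ((x, x) : V * V), `|f p.1 - f p.2| <= K * `|p.1 - p.2|.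
Proof.
split=> h x.
  have [A xA [M [_ /(_ (Num.max 0 M + 1)) hM]]] := h x.
  exists (Num.max 0 M + 1); first by rewrite addr_ge0 // le_max lexx.
  exists (A, A) => //= -[y z] [/= Ay Az]; apply: (hM _ (y, z)) => //=.
  by rewrite ltr_pwDr // le_max lexx orbT.
have [K K0 [[A B] [/= xA xB]] AB] := h x.
exists (A `&` B); first exact: filterI.
exists K; split; first exact: num_real.
move=> M KM -[y z] [/= [Ay _] [_ Bz]].
by apply: (le_trans (AB (y, z) _)) => //=; exact/ler_wpM2r/ltW.
Qed.

Lemma locally_lipschitz_continuous V W (f : V -> W) :
  locally_lipschitz f -> continuous f.
Proof.
move=> /locally_lipschitzP h x; have [K K0 hK] := h x.
apply/cvgrPdist_lt => /= e e0.
have K1 : 0 < K + 1 by rewrite ltr_wpDl.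
have xx : (x, y) @[y --> x] --> (x, x).
  by apply: cvg_pair => /=; [exact: cvg_cst|exact: cvg_id].
near=> y.
apply: (@le_lt_trans _ _ (K * `|x - y|)).
  by near: y; exact: (xx _ hK).
apply: (@le_lt_trans _ _ ((K + 1) * `|x - y|)).
  by rewrite ler_wpM2r // lerDl.
rewrite mulrC -ltr_pdivlMr //.
by near: y; apply: cvgr_dist_lt; rewrite ?divr_gt0//; exact: cvg_id.
Unshelve. all: by end_near. Qed.

Lemma locally_lipschitz_comp V V' W (g : V -> V') (f : V' -> W) :
  locally_lipschitz f -> locally_lipschitz g -> locally_lipschitz (f \o g).
Proof.
move=> lf lg; have cg := locally_lipschitz_continuous lg.
move: lf lg => /locally_lipschitzP lf /locally_lipschitzP lg.
apply/locally_lipschitzP => x.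
have [K K0 hK] := lf (g x); have [L L0 hL] := lg x.
exists (K * L); first exact: mulr_ge0.
have [[A B] [/= gA gB] AB] := hK.
near=> p.
apply: (@le_trans _ _ (K * `|g p.1 - g p.2|)).
  apply: (AB (g p.1, g p.2)); split => /=; near: p.
    exact: near_fst (cg x _ gA).
  exact: near_snd (cg x _ gB).
by rewrite -mulrA ler_wpM2l //; near: p.
Unshelve. all: by end_near. Qed.

Lemma lipschitz_locally_lipschitz V W (f : V -> W) (K : R) : 0 <= K ->
  (forall x y, `|f x - f y| <= K * `|x - y|) -> locally_lipschitz f.
Proof.
move=> K0 h; apply/locally_lipschitzP => x; exists K => //.
by apply: (@nearW _ (nbhs (x, x))) => p; exact: h.
Qed.

Lemma locally_lipschitz_cst V W (c : W) : locally_lipschitz (fun _ : V => c).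
Proof.
apply: (@lipschitz_locally_lipschitz _ _ _ 0) => // x y.
by rewrite subrr normr0 mul0r.
Qed.

Lemma locally_lipschitzD V W (f g : V -> W) :
  locally_lipschitz f -> locally_lipschitz g ->
  locally_lipschitz (fun x => f x + g x).
Proof.
move=> /locally_lipschitzP lf /locally_lipschitzP lg.
apply/locally_lipschitzP => x.
have [K K0 hK] := lf x; have [L L0 hL] := lg x.
exists (K + L); first exact: addr_ge0.
near=> p; rewrite opprD addrACA mulrDl.
by apply: (le_trans (ler_normD _ _)); apply: lerD; near: p.
Unshelve. all: by end_near. Qed.

Lemma locally_lipschitzN V W (f : V -> W) :
  locally_lipschitz f -> locally_lipschitz (fun x => - f x).
Proof.
move=> /locally_lipschitzP lf; apply/locally_lipschitzP => x.
have [K K0 hK] := lf x; exists K => //.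
by near=> p; rewrite -opprD normrN; near: p.
Unshelve. all: by end_near. Qed.

Lemma near_norm_le V W (f : V -> W) x : {for x, continuous f} ->
  \forall y \near x, `|f y| <= `|f x| + 1.
Proof.
move=> cf; near=> y; rewrite -lerBlDl; apply: le_trans (lerB_dist _ _) _.
by rewrite distrC; near: y; apply: cvgr_dist_le.
Unshelve. all: by end_near. Qed.

Lemma locally_lipschitzM V (f g : V -> R) :
  locally_lipschitz f -> locally_lipschitz g ->
  locally_lipschitz (fun x => f x * g x).
Proof.
move=> lf lg.
have cf := locally_lipschitz_continuous lf.
have cg := locally_lipschitz_continuous lg.
move: lf lg => /locally_lipschitzP lf /locally_lipschitzP lg.
apply/locally_lipschitzP => x.
have [K K0 hK] := lf x; have [L L0 hL] := lg x.
exists ((`|f x| + 1) * L + (`|g x| + 1) * K).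
  by rewrite addr_ge0 // mulr_ge0 // addr_ge0.
near=> p.
have -> : f p.1 * g p.1 - f p.2 * g p.2 =
  f p.1 * (g p.1 - g p.2) + g p.2 * (f p.1 - f p.2) by ring.
apply: (le_trans (ler_normD _ _)); rewrite !normrM mulrDl -!mulrA.
apply: lerD; apply: ler_pM => //.
- near: p; have := near_norm_le (cf x).
  exact: near_fst.
- by near: p.
- near: p; have := near_norm_le (cg x).
  exact: near_snd.
- by near: p.
Unshelve. all: by end_near. Qed.

Lemma locally_lipschitz_sum V (I : Type) (r : seq I) (P : pred I) (f : I -> V -> R) :
  (forall i, locally_lipschitz (f i)) ->
  locally_lipschitz (fun x => \sum_(i <- r | P i) f i x).
Proof.
move=> lf; elim: r => [|i r ih].
  by under eq_fun do rewrite big_nil; exact: locally_lipschitz_cst.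
under eq_fun do rewrite big_cons.
by case: (P i) => //; exact: locally_lipschitzD.
Qed.

Lemma locally_lipschitz_prod V (I : Type) (r : seq I) (P : pred I) (f : I -> V -> R) :
  (forall i, locally_lipschitz (f i)) ->
  locally_lipschitz (fun x => \prod_(i <- r | P i) f i x).
Proof.
move=> lf; elim: r => [|i r ih].
  by under eq_fun do rewrite big_nil; exact: locally_lipschitz_cst.
under eq_fun do rewrite big_cons.
by case: (P i) => //; exact: locally_lipschitzM.
Qed.

Lemma locally_lipschitzV V (f : V -> R) : (forall x, f x != 0) ->
  locally_lipschitz f -> locally_lipschitz (fun x => (f x)^-1).
Proof.
move=> f0 lf; have cf := locally_lipschitz_continuous lf.
move: lf => /locally_lipschitzP lf; apply/locally_lipschitzP => x.
have [K K0 hK] := lf x.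
exists ((`|(f x)^-1| + 1) * (`|(f x)^-1| + 1) * K).
  by rewrite !mulr_ge0 // addr_ge0.
have cVf : {for x, continuous (fun y => (f y)^-1)} by apply: cvgV; [exact: f0|exact: cf].
have h := near_norm_le cVf.
near=> p.
have -> : (f p.1)^-1 - (f p.2)^-1 = (f p.1)^-1 * (f p.2)^-1 * - (f p.1 - f p.2).
  by field; rewrite !f0.
rewrite !normrM normrN -!mulrA.
apply: ler_pM => //; first by near: p; exact: (near_fst _ h).
by apply: ler_pM => //; near: p; first exact: (near_snd _ h).
Unshelve. all: by end_near. Qed.

Lemma locally_lipschitz_mxP V p q (f : V -> 'M[R]_(p, q)) :
  locally_lipschitz f <-> forall i j, locally_lipschitz (fun x => f x i j).
Proof.
split=> [/locally_lipschitzP lf i j|lf]; apply/locally_lipschitzP => x.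
  have [K K0 hK] := lf x; exists K => //; near=> z.
  apply: (@le_trans _ _ `|f z.1 - f z.2|); last by near: z.
  by apply: le_trans (ler_mx_norm_coord _ i j); rewrite !mxE.
pose K i j : R := sval (cid2 ((locally_lipschitzP _).1 (lf i j) x)).
have K0 i j : 0 <= K i j by rewrite /K; case: cid2.
have hK i j : \forall p \near ((x, x) : V * V),
    `|f p.1 i j - f p.2 i j| <= K i j * `|p.1 - p.2|.
  by rewrite /K; case: cid2.
exists (\sum_i \sum_j K i j).
  by apply: sumr_ge0 => i _; exact: sumr_ge0.
near=> z; apply/mx_norm_leP.
  by rewrite mulr_ge0 //; apply: sumr_ge0 => i _; exact: sumr_ge0.
move=> i j; apply: (@le_trans _ _ (K i j * `|z.1 - z.2|)).
  rewrite !mxE; move: i j; near: z.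
  by apply: filter_forall => i; apply: filter_forall => j; exact: hK.
rewrite ler_wpM2r //.
rewrite (bigD1 i) //= (bigD1 j) //= -addrA lerDl.
by rewrite addr_ge0 //; apply: sumr_ge0 => // k _; exact: sumr_ge0.
Unshelve. all: by end_near. Qed.

Lemma locally_lipschitz_mulmx V p q r (f : V -> 'M[R]_(p, q)) (g : V -> 'M[R]_(q, r)) :
  locally_lipschitz f -> locally_lipschitz g ->
  locally_lipschitz (fun x => f x *m g x).
Proof.
move=> /locally_lipschitz_mxP lf /locally_lipschitz_mxP lg.
apply/locally_lipschitz_mxP => i j; under eq_fun do rewrite mxE.
by apply: locally_lipschitz_sum => k; exact: locally_lipschitzM.
Qed.

Lemma locally_lipschitz_det V p (f : V -> 'M[R]_p) :
  locally_lipschitz f -> locally_lipschitz (fun x => \det (f x)).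
Proof.
move=> /locally_lipschitz_mxP lf; rewrite /determinant.
apply: locally_lipschitz_sum => s; apply: locally_lipschitzM.
  exact: locally_lipschitz_cst.
by apply: locally_lipschitz_prod => i.
Qed.

(** Cramer's rule. *)
Lemma locally_lipschitz_invmx V p (f : V -> 'M[R]_p) :
  (forall x, f x \in unitmx) ->
  locally_lipschitz f -> locally_lipschitz (fun x => invmx (f x)).
Proof.
move=> uf lf; have /locally_lipschitz_mxP lfij := lf.
apply/locally_lipschitz_mxP => i j.
under eq_fun => x do rewrite /invmx uf !mxE /cofactor.
apply: locally_lipschitzM.
  apply: locally_lipschitzV; last exact: locally_lipschitz_det.
  by move=> x; have := uf x; rewrite unitmxE unitfE.
apply: locally_lipschitzM; first exact: locally_lipschitz_cst.
apply: locally_lipschitz_det; apply/locally_lipschitz_mxP => k l.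
by under eq_fun do rewrite !mxE; exact: lfij.
Qed.

Lemma locally_lipschitz_usubmx n1 n2 :
  locally_lipschitz (fun x : 'cV[R]_(n1 + n2) => usubmx x).
Proof.
apply: (@lipschitz_locally_lipschitz _ _ _ 1) => // x y; rewrite mul1r.
apply/mx_norm_leP => // i j.
by have := ler_mx_norm_coord (x - y) (lshift n2 i) j; rewrite !mxE.
Qed.

Lemma locally_lipschitz_dsubmx n1 n2 :
  locally_lipschitz (fun x : 'cV[R]_(n1 + n2) => dsubmx x).
Proof.
apply: (@lipschitz_locally_lipschitz _ _ _ 1) => // x y; rewrite mul1r.
apply/mx_norm_leP => // i j.
by have := ler_mx_norm_coord (x - y) (rshift n1 i) j; rewrite !mxE.
Qed.

Lemma locally_lipschitz_col_mx V n1 n2 p (f : V -> 'M[R]_(n1, p)) (g : V -> 'M[R]_(n2, p)) :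
  locally_lipschitz f -> locally_lipschitz g ->
  locally_lipschitz (fun x => col_mx (f x) (g x)).
Proof.
move=> /locally_lipschitz_mxP lf /locally_lipschitz_mxP lg.
apply/locally_lipschitz_mxP => i j; under eq_fun do rewrite mxE.
by case: fintype.split => k; [exact: lf|exact: lg].
Qed.

Lemma locally_lipschitz_pair V W W' (f : V -> W) (g : V -> W') :
  locally_lipschitz f -> locally_lipschitz g ->
  locally_lipschitz (fun x => (f x, g x)).
Proof.
move=> /locally_lipschitzP lf /locally_lipschitzP lg.
apply/locally_lipschitzP => x.
have [K K0 hK] := lf x; have [L L0 hL] := lg x.
exists (K + L); first exact: addr_ge0.
near=> p; rewrite prod_normE ge_max /= mulrDl; apply/andP; split.
  by apply: (@le_trans _ _ (K * `|p.1 - p.2|)); [near: p|rewrite lerDl mulr_ge0].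
by apply: (@le_trans _ _ (L * `|p.1 - p.2|)); [near: p|rewrite lerDr mulr_ge0].
Unshelve. all: by end_near. Qed.

(** The inequality with a large enough constant holds near each point (x, y) of
    the compact set Q * Q: if x = y by the local Lipschitz property, otherwise
    because f is locally bounded and |x - y| is bounded away from 0. *)
Lemma locally_lipschitz_compact V W (f : V -> W) (Q : set V) :
  locally_lipschitz f -> compact Q ->
  exists2 K : R, 0 <= K &
    forall x y, Q x -> Q y -> `|f x - f y| <= K * `|x - y|.
Proof.
move=> lf cQ; have cf := locally_lipschitz_continuous lf.
move: lf => /locally_lipschitzP lf.
have cQQ := compact_setX cQ cQ.
have := (compact_near_coveringP _).1 cQQ R (pinfty_nbhs R)
  (fun K z => `|f z.1 - f z.2| <= K * `|z.1 - z.2|) _.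
case=> [|M [_ hM]]; last first.
  exists (Num.max 0 M + 1); first by rewrite addr_ge0 // le_max lexx.
  move=> x y Qx Qy; apply: (hM _ _ (x, y)) => //=.
  by rewrite ltr_pwDr // le_max lexx orbT.
move=> [x y] _ /=; have [<-|xy] := eqVneq x y.
  have [K K0 hK] := lf x.
  near=> z K' => /=.
  apply: (@le_trans _ _ (K * `|z.1 - z.2|)); first by near: z.
  by rewrite ler_wpM2r //; near: K'; apply: nbhs_pinfty_ge; exact: num_real.
have d0 : 0 < `|x - y| by rewrite normr_gt0 subr_eq0.
have d4 : 0 < `|x - y| / 4 by rewrite divr_gt0.
near=> z K' => /=.
apply: (@le_trans _ _ ((`|f x - f y| + 1) / (`|x - y| / 2) * `|z.1 - z.2|)).
  rewrite mulrAC ler_pdivlMr ?divr_gt0 //.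
  have fx1 : `|f x - f z.1| <= 2^-1.
    near: z; apply: (@near_fst _ _ x y (fun v => `|f x - f v| <= 2^-1)).
    by apply: cvgr_dist_le; [exact: cf|rewrite invr_gt0].
  have fy1 : `|f y - f z.2| <= 2^-1.
    near: z; apply: (@near_snd _ _ x y (fun v => `|f y - f v| <= 2^-1)).
    by apply: cvgr_dist_le; [exact: cf|rewrite invr_gt0].
  have x1 : `|x - z.1| <= `|x - y| / 4.
    near: z; apply: (@near_fst _ _ x y (fun v => `|x - v| <= `|x - y| / 4)).
    by apply: cvgr_dist_le d4; exact: cvg_id.
  have y1 : `|y - z.2| <= `|x - y| / 4.
    near: z; apply: (@near_snd _ _ x y (fun v => `|y - v| <= `|x - y| / 4)).
    by apply: cvgr_dist_le d4; exact: cvg_id.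
  apply: ler_pM => //.
    have := ler_distD (f x) (f z.1) (f z.2); have := ler_distD (f y) (f x) (f z.2).
    by rewrite (distrC (f z.1) (f x)); move: fx1 fy1; lra.
  have := ler_distD z.1 x y; have := ler_distD z.2 z.1 y.
  by rewrite (distrC z.2 y); move: x1 y1; lra.
by rewrite ler_wpM2r //; near: K'; apply: nbhs_pinfty_ge; exact: num_real.
Unshelve. all: by end_near. Qed.

End LocallyLipschitz.

(** * Differential inequalities and primitives *)

Section RealCalculus.
Context {R : realType}.

Lemma is_derive_mxP p q (f : R -> 'M[R]_(p, q)) (t : R) (df : 'M[R]_(p, q)) :
  is_derive t (1 : R) f df <->
  forall i j, is_derive t (1 : R) (fun s => f s i j) (df i j).
Proof.
split=> [[d <-] i j|h].
  split; first exact: (derivable_mxP f t 1).1.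
  by rewrite (derive_mx d) mxE.
have d : derivable f t 1 by apply/derivable_mxP => i j; case: (h i j).
split=> //; rewrite derive_mx //; apply/matrixP => i j; rewrite mxE.
by case: (h i j).
Qed.

Lemma is_derive_continuous (W : normedModType R) (f : R -> W) (t : R) df :
  is_derive t (1 : R) f df -> {for t, continuous f}.
Proof. by case=> /derivable1_diffP/differentiable_continuous. Qed.

Lemma is_derive_nonneg_le (f df : R -> R) (a b : R) : a <= b ->
  (forall t, a <= t <= b -> is_derive t (1 : R) f (df t)) ->
  (forall t, a <= t <= b -> 0 <= df t) -> f a <= f b.
Proof.
move=> ab fdf df0.
have [||c] := @MVT_segment R f df a b ab.
- by move=> x; rewrite in_itv /= => /andP[ax xb]; apply: fdf; rewrite !ltW.
- apply: derivable_within_continuous => x; rewrite in_itv /= => xab.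
  by case: (fdf x xab).
rewrite in_itv /= => cab /eqP; rewrite subr_eq => /eqP ->.
by rewrite lerDr mulr_ge0 ?subr_ge0 // df0.
Qed.

Lemma is_derive_opp (W : normedModType R) (f : R -> W) (t : R) df :
  is_derive (- t) (1 : R) f df -> is_derive t (1 : R) (fun s => f (- s)) (- df).
Proof.
move=> [/derivable1_diffP fd <-].
have od : differentiable (fun s : R => - s) t by apply: differentiableN.
have d : differentiable (f \o (fun s : R => - s)) t by exact: differentiable_comp.
split; first exact/derivable1_diffP.
rewrite deriveE // diff_comp //= deriveE //= -linearN; congr (_ _).
by rewrite -deriveE // derive_val.
Qed.

(** The function (E + a / b) exp (- b t) is nonincreasing. *)
Lemma gronwall (E dE : R -> R) (a b T : R) : 0 < b -> 0 <= T ->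
  (forall t, 0 <= t <= T -> is_derive t (1 : R) E (dE t)) ->
  (forall t, 0 <= t <= T -> dE t <= a + b * E t) ->
  E T <= (E 0 + a / b) * expR (b * T) - a / b.
Proof.
move=> b0 T0 EdE dEle.
pose g t := - ((E t + a / b) * expR (- (b * t))).
have bE : b * (a / b) = a by rewrite mulrCA divff ?mulr1 // gt_eqF.
have : g 0 <= g T.
  apply: (@is_derive_nonneg_le g (fun t => (a + b * E t - dE t) * expR (- (b * t)))) => //.
    move=> t tT; have dEt := EdE t tT.
    have dlin : is_derive t (1 : R) (fun t => - (b * t)) (- b).
      have := is_deriveN (is_deriveZ b (is_derive_id t (1 : R))).
      by move/is_derive_eq; apply; rewrite /= /GRing.scale /= mulr1.
    have dexp : is_derive t (1 : R) (fun t => expR (- (b * t))) (expR (- (b * t)) * - b).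
      exact: (is_derive1_comp (is_derive_expR _) dlin).
    have dA : is_derive t (1 : R) (fun t => E t + a / b) (dE t).
      by have := is_deriveD dEt (is_derive_cst (a / b) t (1 : R)); rewrite addr0.
    have := is_deriveN (is_deriveM dA dexp).
    move/is_derive_eq; apply; rewrite /GRing.scale /=.
    set e := expR _.
    have -> : a + b * E t = b * (E t + a / b) by rewrite mulrDr bE addrC.
    ring.
  by move=> t tT; rewrite mulr_ge0 ?expR_ge0 // subr_ge0 dEle.
rewrite /g mulr0 oppr0 expR0 mulr1 lerN2 => h.
rewrite lerBrDr.
rewrite -(ler_pM2r (expR_gt0 (- (b * T)))) -mulrA -expRD subrr expR0 mulr1.
exact: h.
Qed.

(** The weight exp (L |s|) is the one for which Picard iteration is a
    contraction on the whole line: integration gains a factor 1 / L. *)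
Lemma ler_norm_derive_expR (u du : R -> R) (A L t : R) : 0 < L -> u 0 = 0 ->
  (forall s, is_derive s (1 : R) u (du s)) ->
  (forall s, `|du s| <= A * expR (L * `|s|)) ->
  `|u t| <= A / L * expR (L * `|t|).
Proof.
move=> L0 u0 udu dub.
have A0 : 0 <= A.
  by have := le_trans (normr_ge0 _) (dub 0); rewrite normr0 mulr0 expR0 mulr1.
have half (v dv : R -> R) r : v 0 = 0 -> 0 <= r ->
    (forall s, is_derive s (1 : R) v (dv s)) ->
    (forall s, `|dv s| <= A * expR (L * `|s|)) ->
    v r <= A / L * expR (L * r).
  move=> v0 r0 vdv dvb.
  pose g s := A / L * expR (L * s) - v s.
  have : g 0 <= g r.
    apply: (@is_derive_nonneg_le g (fun s => A * expR (L * s) - dv s)) => //.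
      move=> s _; have dlin : is_derive s (1 : R) (fun t => L * t) L.
        have := is_deriveZ L (is_derive_id s (1 : R)).
        by move/is_derive_eq; apply; rewrite /GRing.scale /= mulr1.
      have dexp : is_derive s (1 : R) (fun t => expR (L * t)) (expR (L * s) * L).
        exact: (is_derive1_comp (is_derive_expR _) dlin).
      have := is_deriveB (is_deriveZ (A / L) dexp) (vdv s).
      move/is_derive_eq; apply; rewrite /GRing.scale /=.
      by field; rewrite gt_eqF.
    move=> s /andP[s0 _]; have := dvb s; rewrite (ger0_norm s0).
    by rewrite subr_ge0; exact: le_trans (ler_norm _).
  rewrite /g v0 mulr0 expR0 mulr1 subr0 lerBrDl.
  by move=> h; apply: le_trans h; rewrite lerDl divr_ge0 // ltW.
have Nu0 : - u 0 = 0 by rewrite u0 oppr0.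
have [t0|/ltW t0] := leP 0 t.
  rewrite ler_norml (ger0_norm t0) (half u du) // andbT lerNl.
  apply: (half (fun s => - u s) (fun s => - du s)) => // s.
  by rewrite normrN.
have Nt0 : 0 <= - t by rewrite oppr_ge0.
rewrite ler_norml (ler0_norm t0) lerNl; apply/andP; split.
  have := half (fun s => - u (- s)) (fun s => du (- s)) (- t); rewrite opprK.
  apply=> // [|s|s].
  - by rewrite oppr0.
  - by have := is_deriveN (is_derive_opp (udu (- s))); rewrite opprK.
  - by rewrite -[`|s|]normrN; exact: dub.
have := half (fun s => u (- s)) (fun s => - du (- s)) (- t); rewrite opprK.
apply=> // [|s|s].
- by rewrite oppr0.
- exact: is_derive_opp.
- by rewrite normrN -[`|s|]normrN; exact: dub.
Qed.

Lemma is_derive_0_eq (f : R -> R) (a b : R) : a <= b ->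
  (forall t, a <= t <= b -> is_derive t (1 : R) f 0) -> f a = f b.
Proof.
move=> ab f0; apply/eqP; rewrite eq_le; apply/andP; split.
  exact: (is_derive_nonneg_le ab f0).
rewrite -lerN2.
apply: (@is_derive_nonneg_le (fun s => - f s) (fun=> 0) a b) => // t tab.
by have := is_deriveN (f0 t tab); rewrite oppr0.
Qed.

(** The integral from -W is a primitive on ]-W, W[ only.  Normalised at 0, the
    primitives obtained for different W agree where both are defined, and are
    glued by using W = |t| + 1 at time t. *)
Lemma continuous_primitive (f : R -> R) : continuous f ->
  exists2 F : R -> R, F 0 = 0 & forall t, is_derive t (1 : R) F (f t).
Proof.
move=> cf.
have window (W : R) : exists2 F : R -> R, F 0 = 0 &
    forall t, `|t| < W -> is_derive t (1 : R) F (f t).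
  pose I t := (\int[@lebesgue_measure R]_(s in `[- W, t]) f s)%R.
  exists (fun t => I t - I 0); first by rewrite subrr.
  move=> t; rewrite ltr_norml => /andP[Wt tW].
  have intf : (@lebesgue_measure R).-integrable `[- W, W] (EFin \o f).
    apply: continuous_compact_integrable; first exact: segment_compact.
    exact: continuous_subspaceT.
  have [dI I'] := continuous_FTC1_closed tW intf Wt (cf t).
  have dIt : is_derive t (1 : R) I (f t) by split=> //; rewrite -derive1E.
  by have := is_deriveB dIt (is_derive_cst (I 0) t (1 : R)); rewrite subr0.
pose G W : R -> R := sval (cid2 (window W)).
have G0 W : G W 0 = 0 by rewrite /G; case: cid2.
have dG W t : `|t| < W -> is_derive t (1 : R) (G W) (f t).
  by rewrite /G; case: cid2 => F ? h; exact: h.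
have GG W W' s : `|s| < W -> `|s| < W' -> G W s = G W' s.
  move=> sW sW'; apply/eqP; rewrite -subr_eq0; apply/eqP.
  have d r : `|r| <= `|s| -> is_derive r (1 : R) (fun r => G W r - G W' r) 0.
    move=> rs; have := is_deriveB (dG W r (le_lt_trans rs sW)) (dG W' r (le_lt_trans rs sW')).
    by rewrite subrr.
  have z : G W 0 - G W' 0 = 0 by rewrite !G0 subrr.
  have [s0|/ltW s0] := leP 0 s.
    rewrite -z; apply/esym/(@is_derive_0_eq (fun r => G W r - G W' r) 0 s s0) => r /andP[r0 rs].
    by apply: d; rewrite !ger0_norm // (le_trans r0).
  rewrite -z; apply: (@is_derive_0_eq (fun r => G W r - G W' r) s 0 s0) => r /andP[sr r0].
  by apply: d; rewrite !ler0_norm ?lerN2 // (le_trans sr).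
exists (fun t => G (`|t| + 1) t) => [//|t].
apply: (@near_eq_is_derive _ _ _ (G (`|t| + 2))).
- near=> s; apply: GG; last by rewrite ltrDl.
  have : `|t - s| < 1 by near: s; apply: cvgr_dist_lt => //; exact: cvg_id.
  by have := lerB_dist s t; rewrite distrC; lra.
- by apply: dG; rewrite ltrDl.
Unshelve. all: by end_near. Qed.

End RealCalculus.

(** * Existence for Lipschitz fields and uniqueness *)

Section CauchyLipschitz.
Context {R : realType}.

Lemma geometric_cauchy N (u : nat -> 'cV[R]_N) (A : R) :
  (forall k, `|u k.+1 - u k| <= A * 2^-1 ^+ k) ->
  exists l, forall k, `|l - u k| <= 2 * A * 2^-1 ^+ k.
Proof.
move=> uA.
have A0 : 0 <= A.
  by have := le_trans (normr_ge0 _) (uA 0%N); rewrite expr0 mulr1.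
have half_cvg : (2 * A * 2^-1 ^+ k) @[k --> \oo] --> (0 : R).
  by apply: (@cvg_geometric _ (2 * A) 2^-1); rewrite ger0_norm ?invf_lt1 ?ltr1n.
have far k j : `|u (k + j)%N - u k| <= 2 * A * 2^-1 ^+ k - 2 * A * 2^-1 ^+ (k + j).
  elim: j => [|j ih]; first by rewrite addn0 !subrr normr0.
  apply: le_trans (ler_distD (u (k + j)%N) _ _) _.
  rewrite addnS; have := uA (k + j)%N; rewrite exprS.
  by move: ih; lra.
have far' k n : (k <= n)%N -> `|u n - u k| <= 2 * A * 2^-1 ^+ k.
  move=> /subnKC <-; apply: le_trans (far k _) _.
  by rewrite gerBl !mulr_ge0 // exprn_ge0.
have cu : cvgn u.
  apply/cauchy_cvgP; apply: cauchy_exP => e e0.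
  have [k _ /(_ k (leqnn k)) /= hk] := (cvgrPdist_lt _ _).1 half_cvg e e0.
  exists (u k); exists k => // n /= kn; rewrite -ball_normE /= distrC.
  apply: le_lt_trans (far' k n kn) _.
  by move: hk; rewrite sub0r normrN; exact: le_lt_trans (ler_norm _).
exists (limn u) => k; apply/ler_addgt0Pr => e e0.
near \oo => n.
apply: le_trans (ler_distD (u n) _ _) _; rewrite addrC lerD //.
  by apply: far'; near: n; exact: nbhs_infty_ge.
by near: n; exact: (cvgrPdist_le _ _).1 cu _ e0.
Unshelve. all: by end_near. Qed.

Lemma continuous_primitive_col N (g : R -> 'cV[R]_N) : continuous g ->
  exists P : R -> 'cV[R]_N, P 0 = 0 /\ forall t, is_derive t (1 : R) P (g t).
Proof.
move=> cg.
have /choice[P hP] i : exists F : R -> R, F 0 = 0 /\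
    forall t, is_derive t (1 : R) F (g t i 0).
  have [F F0 dF] : exists2 F : R -> R, F 0 = 0 &
      forall t, is_derive t (1 : R) F (g t i 0).
    apply: continuous_primitive => t.
    apply: (@continuous_comp _ _ _ g (fun M : 'cV[R]_N => M i 0)); first exact: cg.
    exact: (@coord_continuous _ _ _ i 0 (g t)).
  by exists F.
exists (fun t => \col_i P i t); split.
  by apply/colP => i; rewrite !mxE; case: (hP i).
move=> t; apply/is_derive_mxP => i j; rewrite ord1.
by under eq_fun do rewrite mxE; case: (hP i).
Qed.

Lemma ler_norm_derive_expR_col N (u du : R -> 'cV[R]_N) (A L t : R) :
  0 < L -> u 0 = 0 ->
  (forall s, is_derive s (1 : R) u (du s)) ->
  (forall s, `|du s| <= A * expR (L * `|s|)) ->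
  `|u t| <= A / L * expR (L * `|t|).
Proof.
move=> L0 u0 udu dub.
have A0 : 0 <= A.
  by have := le_trans (normr_ge0 _) (dub 0); rewrite normr0 mulr0 expR0 mulr1.
apply/mx_norm_leP => [|i j].
  by rewrite mulr_ge0 ?expR_ge0 // divr_ge0 // ltW.
apply: (@ler_norm_derive_expR _ (fun s => u s i j) (fun s => du s i j)) => //.
- by rewrite u0 mxE.
- by move=> s; exact: (is_derive_mxP _ _ _).1 (udu s) i j.
- by move=> s; exact: le_trans (ler_mx_norm_coord _ i j) (dub s).
Qed.

(** Picard iteration.  With L = 2 K each step halves the distance to the
    previous iterate in the norm sup_t |phi t| exp (- L |t|). *)
Lemma global_lipschitz_solution N (G : 'cV[R]_N -> 'cV[R]_N) (K : R) x0 :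
  (forall x y, `|G x - G y| <= K * `|x - y|) ->
  exists phi : R -> 'cV[R]_N,
    phi 0 = x0 /\ forall t, is_derive t (1 : R) phi (G (phi t)).
Proof.
wlog K0 : K / 0 < K => [wl|] GK.
  apply: (wl (`|K| + 1)); first by rewrite ltr_wpDl.
  move=> x y; apply: le_trans (GK x y) _; rewrite ler_wpM2r //.
  by apply: le_trans (ler_norm _) _; rewrite lerDl.
have cG : continuous G.
  by apply: locally_lipschitz_continuous; exact: lipschitz_locally_lipschitz (ltW K0) GK.
pose prim (g : R -> 'cV[R]_N) := get [set P : R -> 'cV[R]_N |
  P 0 = 0 /\ forall t, is_derive t (1 : R) P (g t)].
have primP g : continuous g ->
    prim g 0 = 0 /\ forall t, is_derive t (1 : R) (prim g) (g t).
  by move=> /continuous_primitive_col[P hP]; exact: (@getI _ [set P : R -> 'cV[R]_N |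
  P 0 = 0 /\ forall t, is_derive t (1 : R) P (g t)] P hP).
pose step (f : R -> 'cV[R]_N) t := x0 + prim (G \o f) t.
have stepP f : continuous f ->
    step f 0 = x0 /\ forall t, is_derive t (1 : R) (step f) (G (f t)).
  move=> cf; have [|p0 dp] := primP (G \o f).
    by move=> t; apply: continuous_comp; [exact: cf|exact: cG].
  split; first by rewrite /step p0 addr0.
  by move=> t; have := is_deriveD (is_derive_cst x0 t (1 : R)) (dp t); rewrite add0r.
pose phi k := iter k step (cst x0).
have cphi k : continuous (phi k).
  elim: k => [|k ih]; first exact: cst_continuous.
  by move=> t; have [_ /(_ t)/is_derive_continuous] := stepP _ ih.
have phi0 k : phi k 0 = x0.
  by case: k => // k; have [] := stepP _ (cphi k).
have dphi k t : is_derive t (1 : R) (phi k.+1) (G (phi k t)).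
  by have [_] := stepP _ (cphi k).
pose L := 2 * K; have L0 : 0 < L by rewrite mulr_gt0.
pose M := `|G x0|; have M0 : 0 <= M by exact: normr_ge0.
pose C (t : R) : R := M / L * expR (L * `|t|).
have KL : K / L = 2^-1 by rewrite /L; field; rewrite gt_eqF.
have incr k t : `|phi k.+1 t - phi k t| <= C t * 2^-1 ^+ k.
  elim: k t => [|k ih] t.
    rewrite expr0 mulr1.
    apply: (@ler_norm_derive_expR_col _ (fun s => phi 1%N s - phi 0%N s)
      (fun s => G x0)) => // [|s|s].
    - by rewrite !phi0 subrr.
    - have := is_deriveB (dphi 0%N s) (is_derive_cst x0 s (1 : R)).
      by rewrite subr0.
    - rewrite -[leLHS]mulr1 ler_wpM2l // -expR0 ler_expR.
      by rewrite mulr_ge0 // ltW.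
  have -> : C t * 2^-1 ^+ k.+1 = M / L * 2^-1 ^+ k * K / L * expR (L * `|t|).
    by rewrite /C exprS -KL; ring.
  apply: (@ler_norm_derive_expR_col _ (fun s => phi k.+2 s - phi k.+1 s)
      (fun s => G (phi k.+1 s) - G (phi k s))) => // [|s].
  - by rewrite !phi0 subrr.
  - apply: le_trans (GK _ _) _.
    apply: le_trans (ler_wpM2l (ltW K0) (ih s)) _.
    by rewrite /C le_eqVlt; apply/orP; left; apply/eqP; ring.
have /choice[lphi hl] t : exists l, forall k, `|l - phi k t| <= 2 * C t * 2^-1 ^+ k.
  by apply: geometric_cauchy => k; exact: incr.
have half_cvg (A : R) : (A * 2^-1 ^+ k) @[k --> \oo] --> (0 : R).
  by apply: (@cvg_geometric _ A 2^-1); rewrite ger0_norm ?invf_lt1 ?ltr1n.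
have clphi : continuous lphi.
  move=> t; apply/cvgrPdist_lt => /= e e0.
  have e3 : 0 < e / 3 by rewrite divr_gt0.
  pose A := 2 * (M / L * expR (L * (`|t| + 1))).
  have Abound s : `|t - s| < 1 -> forall k, `|lphi s - phi k s| <= A * 2^-1 ^+ k.
    move=> ts k; apply: le_trans (hl s k) _.
    apply: ler_wpM2r; first by rewrite exprn_ge0 // invr_ge0.
    apply: ler_wpM2l => //; apply: ler_wpM2l; first by rewrite divr_ge0 // ltW.
    rewrite ler_expR ler_pM2l //.
    by have := lerB_dist s t; rewrite distrC; move: ts; lra.
  have [k _ /(_ k (leqnn k)) /= hk] := (cvgrPdist_lt _ _).1 (half_cvg A) _ e3.
  have {}hk : A * 2^-1 ^+ k < e / 3.
    by move: hk; rewrite sub0r normrN; exact: le_lt_trans (ler_norm _).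
  near=> s.
  have ts : `|t - s| < 1 by near: s; apply: cvgr_dist_lt => //; exact: cvg_id.
  have h1 : `|phi k t - phi k s| < e / 3.
    by near: s; apply: cvgr_dist_lt e3; exact: cphi.
  have h2 := Abound s ts k.
  have h3 : `|lphi t - phi k t| <= A * 2^-1 ^+ k.
    by apply: Abound; rewrite subrr normr0.
  have := ler_distD (phi k t) (lphi t) (lphi s).
  have := ler_distD (phi k s) (phi k t) (lphi s).
  by rewrite (distrC (phi k s) (lphi s)); lra.
have [s0 ds] := stepP _ clphi.
suff E : lphi = step lphi.
  by exists lphi; split=> [|t]; [rewrite E|rewrite {1}E].
apply/funext => t; apply/eqP; rewrite -subr_eq0 -normr_le0.
apply/ler_addgt0Pr => e e0; rewrite add0r.
have bound k : `|lphi t - step lphi t| <= 2 * C t * 2^-1 ^+ k.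
  have h : `|phi k.+1 t - step lphi t| <= C t * 2^-1 ^+ k.
    have -> : C t * 2^-1 ^+ k = 2 * (M / L) * 2^-1 ^+ k * K / L * expR (L * `|t|).
      by rewrite /C -[_ * K / L]mulrA KL; field; rewrite gt_eqF.
    apply: (@ler_norm_derive_expR_col _ (fun s => phi k.+1 s - step lphi s)
      (fun s => G (phi k s) - G (lphi s))) => // [|s].
    - by rewrite phi0 s0 subrr.
    - apply: le_trans (GK _ _) _; rewrite distrC.
      apply: le_trans (ler_wpM2l (ltW K0) (hl s k)) _.
      by rewrite /C le_eqVlt; apply/orP; left; apply/eqP; ring.
  have := ler_distD (phi k.+1 t) (lphi t) (step lphi t).
  by have := hl t k.+1; rewrite exprS; lra.
have [k _ /(_ k (leqnn k)) /= hk] := (cvgrPdist_lt _ _).1 (half_cvg (2 * C t)) _ e0.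
apply: le_trans (bound k) _; apply: ltW.
by move: hk; rewrite sub0r normrN; exact: le_lt_trans (ler_norm _).
Unshelve. all: by end_near. Qed.

Lemma is_derive_bigsum n (h : 'I_n -> R -> R) (dh : 'I_n -> R) (t : R) :
  (forall i, is_derive t (1 : R) (h i) (dh i)) ->
  is_derive t (1 : R) (fun s => \sum_i h i s) (\sum_i dh i).
Proof.
move=> hd; have := is_derive_sum hd.
by congr (is_derive _ _ _ _); apply/funext => s; rewrite fct_sumE.
Qed.

Lemma is_derive_mul (f g : R -> R) (t df dg : R) :
  is_derive t (1 : R) f df -> is_derive t (1 : R) g dg ->
  is_derive t (1 : R) (fun s => f s * g s) (df * g t + f t * dg).
Proof.
move=> fd gd; have := is_deriveM fd gd.
by move/is_derive_eq; apply; rewrite /GRing.scale /=; ring.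
Qed.

Lemma segment_bounded N (f : R -> 'cV[R]_N) (T : R) :
  (forall t, 0 <= t <= T -> {for t, continuous f}) ->
  exists2 r : R, 0 <= r & forall t, 0 <= t <= T -> `|f t| <= r.
Proof.
move=> cf.
have cptf : compact (f @` `[0, T]%classic).
  apply: continuous_compact; last exact: segment_compact.
  by apply: continuous_in_subspaceT => t; rewrite inE /= in_itv /=; exact: cf.
have [M [_ hM]] := compact_bounded cptf.
exists (`|M| + 1); first by rewrite addr_ge0.
move=> t tT; apply: (hM (`|M| + 1)); last by exists t => //=; rewrite in_itv.
by apply: le_lt_trans (ler_norm M) _; rewrite ltrDl.
Qed.

(** Both solutions remain in a cube over [0, T], where F has a Lipschitz
    constant K; the square of the Euclidean norm of their difference satisfies
    E' <= (2 K N + 1) E and vanishes at 0. *)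
Lemma solution_unique_forward N (F : 'cV[R]_N -> 'cV[R]_N) (phi psi : R -> 'cV[R]_N) (T : R) :
  locally_lipschitz F -> 0 <= T -> phi 0 = psi 0 ->
  (forall t, 0 <= t <= T -> is_derive t (1 : R) phi (F (phi t))) ->
  (forall t, 0 <= t <= T -> is_derive t (1 : R) psi (F (psi t))) ->
  phi T = psi T.
Proof.
move=> lF T0 e0 dphi dpsi.
have [r r0 phir] : exists2 r : R, 0 <= r & forall t, 0 <= t <= T -> `|phi t| <= r.
  by apply: segment_bounded => t /dphi/is_derive_continuous.
have [r' _ psir] : exists2 r : R, 0 <= r & forall t, 0 <= t <= T -> `|psi t| <= r.
  by apply: segment_bounded => t /dpsi/is_derive_continuous.
have [K K0 FK] := locally_lipschitz_compact lF (@compact_norm_le _ N (Num.max r r')).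
pose w (t : R) : 'cV[R]_N := phi t - psi t.
pose E (t : R) : R := \sum_i w t i 0 * w t i 0.
pose dw (t : R) : 'cV[R]_N := F (phi t) - F (psi t).
pose dE (t : R) : R := \sum_i (dw t i 0 * w t i 0 + w t i 0 * dw t i 0).
have wE t : `|w t| * `|w t| <= E t.
  have Eik i : w t i 0 ^+ 2 <= E t.
    rewrite /E (bigD1 i) //= -expr2 lerDl.
    by apply: sumr_ge0 => k _; rewrite -expr2 sqr_ge0.
  have E0 : 0 <= E t by apply: sumr_ge0 => k _; rewrite -expr2 sqr_ge0.
  have h : `|w t| <= Num.sqrt (E t).
    apply/mx_norm_leP => [|i j]; first exact: sqrtr_ge0.
    by rewrite ord1 -sqrtr_sqr ler_sqrt.
  rewrite -[leRHS]sqr_sqrtr // expr2.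
  by apply: ler_pM.
have dEb t : 0 <= t <= T -> dE t <= 0 + (2 * K * N%:R + 1) * E t.
  move=> tT; have E0 : 0 <= E t by apply: sumr_ge0 => k _; rewrite -expr2 sqr_ge0.
  have dwb : `|dw t| <= K * `|w t|.
    apply: FK => /=; first by rewrite le_max phir.
    by rewrite le_max psir ?orbT.
  have term i : dw t i 0 * w t i 0 <= K * E t.
    apply: le_trans (ler_norm _) _; rewrite normrM.
    apply: (@le_trans _ _ (K * `|w t| * `|w t|)).
      apply: ler_pM => //; last exact: ler_mx_norm_coord.
      exact: le_trans (ler_mx_norm_coord _ i 0) dwb.
    by rewrite -mulrA ler_wpM2l.
  apply: (@le_trans _ _ (\sum_(i < N) 2 * (K * E t))).
    apply: ler_sum => i _; rewrite (mulrC (w t i 0)).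
    by have := term i; lra.
  rewrite sumr_const card_ord -mulr_natr; lra.
have := @gronwall _ E dE 0 (2 * K * N%:R + 1) T.
rewrite ltr_wpDl // ?mulr_ge0 // => /(_ isT T0).
have h1 t : 0 <= t <= T -> is_derive t (1 : R) E (dE t).
  move=> tT; apply: is_derive_bigsum => i.
  have dwi : is_derive t (1 : R) (fun s => w s i 0) (dw t i 0).
    by apply: (is_derive_mxP _ _ _).1; exact: is_deriveB (dphi t tT) (dpsi t tT).
  exact: is_derive_mul.
move=> /(_ h1 dEb); rewrite mul0r addr0 subr0.
have -> : E 0 = 0 by rewrite /E big1 // => i _; rewrite /w e0 subrr mxE mul0r.
rewrite mul0r => ET0.
have wT0 : `|w T| * `|w T| <= 0 := le_trans (wE T) ET0.
apply/eqP; rewrite -subr_eq0 -normr_eq0 -sqrf_eq0 eq_le sqr_ge0 andbT expr2.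
exact: wT0.
Qed.

Lemma solution_unique N (F : 'cV[R]_N -> 'cV[R]_N) (phi psi : R -> 'cV[R]_N) (J : set R) (t : R) :
  locally_lipschitz F -> is_interval J -> J 0 -> J t -> phi 0 = psi 0 ->
  (forall s, J s -> is_derive s (1 : R) phi (F (phi s))) ->
  (forall s, J s -> is_derive s (1 : R) psi (F (psi s))) ->
  phi t = psi t.
Proof.
move=> lF iJ J0 Jt e0 dphi dpsi.
have [t0|/ltW t0] := leP 0 t.
  by apply: (solution_unique_forward lF t0 e0) => s st;
    [apply: dphi|apply: dpsi]; exact: iJ J0 Jt _ st.
have Nt0 : 0 <= - t by rewrite oppr_ge0.
rewrite -[t]opprK.
apply: (@solution_unique_forward _ (fun x => - F x)
  (fun s => phi (- s)) (fun s => psi (- s))) => //.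
- exact: locally_lipschitzN.
- by rewrite oppr0.
- move=> s st; apply: is_derive_opp; apply: dphi.
  by apply: (iJ _ _ Jt J0); rewrite lerNr andbC oppr_le0.
- move=> s st; apply: is_derive_opp; apply: dpsi.
  by apply: (iJ _ _ Jt J0); rewrite lerNr andbC oppr_le0.
Qed.

End CauchyLipschitz.

(** * A priori bounds and maximal solutions *)

Section Continuation.
Context {R : realType}.

(** The projection onto the sup-norm ball of radius r. *)
Definition clamp N (r : R) (x : 'cV[R]_N) : 'cV[R]_N :=
  \col_i Num.max (- r) (Num.min r (x i 0)).

Lemma clamp_id N r (x : 'cV[R]_N) : `|x| <= r -> clamp r x = x.
Proof.
move=> xr; apply/colP => i; rewrite mxE.
have : `|x i 0| <= r := le_trans (ler_mx_norm_coord x i 0) xr.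
by rewrite ler_norml => /andP[h1 h2]; rewrite (min_idPr h2) (max_idPr h1).
Qed.

Lemma norm_clamp_le N r (x : 'cV[R]_N) : 0 <= r -> `|clamp r x| <= r.
Proof.
move=> r0; apply/mx_norm_leP => // i j; rewrite mxE ler_norml le_max lexx /=.
by rewrite ge_max ge_min lexx andbT -subr_ge0 opprK addr_ge0.
Qed.

Lemma clamp_lipschitz N r (x y : 'cV[R]_N) : `|clamp r x - clamp r y| <= `|x - y|.
Proof.
apply/mx_norm_leP => // i j; rewrite !mxE.
apply: (@le_trans _ _ `|x i 0 - y i 0|); last first.
  by have := ler_mx_norm_coord (x - y) i 0; rewrite !mxE.
move: (x i 0) (y i 0) => a b.
have maxB (s c d : R) : `|Num.max s c - Num.max s d| <= `|c - d|.
  have := ler_norm (c - d); have := ler_norm (d - c); rewrite distrC => h1 h2.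
  by rewrite ler_norml; case: (leP s c) => ?; case: (leP s d) => ?; apply/andP; split; lra.
have minB (s c d : R) : `|Num.min s c - Num.min s d| <= `|c - d|.
  have := ler_norm (c - d); have := ler_norm (d - c); rewrite distrC => h1 h2.
  by rewrite ler_norml; case: (leP s c) => ?; case: (leP s d) => ?; apply/andP; split; lra.
exact: le_trans (maxB _ _ _) (minB _ _ _).
Qed.

(** The solution phi of the equation for the clamped field solves the original
    equation as long as it stays in the cube of radius r > rho.  At the first
    time c at which |phi c| >= r it would still have done so, hence
    |phi c| <= rho < r. *)
Lemma bounded_solution_exists N (F : 'cV[R]_N -> 'cV[R]_N) x0 (T rho : R) :
  locally_lipschitz F -> 0 <= T ->
  (forall s psi, 0 <= s <= T -> psi 0 = x0 ->
    (forall t, 0 <= t <= s -> is_derive t (1 : R) psi (F (psi t))) ->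
    `|psi s| <= rho) ->
  exists2 e : R, 0 < e & exists phi : R -> 'cV[R]_N, phi 0 = x0 /\
    forall t, - e < t < T + e -> is_derive t (1 : R) phi (F (phi t)).
Proof.
move=> lF T0 apriori; pose r := `|x0| + `|rho| + 1.
have r0 : 0 <= r by rewrite !addr_ge0.
have [K K0 FK] := locally_lipschitz_compact lF (@compact_norm_le _ N r).
have [|phi [phi0 dphi]] := @global_lipschitz_solution _ N (F \o clamp r) K x0.
  move=> x y /=; apply: le_trans (FK _ _ _ _) _; [exact: norm_clamp_le..|].
  by rewrite ler_wpM2l // clamp_lipschitz.
have dphiF t : `|phi t| <= r -> is_derive t (1 : R) phi (F (phi t)).
  by move=> h; have := dphi t; rewrite /= clamp_id.
have cphi t : {for t, continuous (fun s => `|phi s|)}.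
  by apply: cvg_norm; exact: is_derive_continuous (dphi t).
have inside t : 0 <= t <= T -> `|phi t| < r.
  move=> tT; rewrite ltNge; apply/negP => rt.
  pose A := [set s : R | 0 <= s <= T /\ r <= `|phi s|].
  have cA : compact A.
    have -> : A = `[0, T]%classic `&` (fun s => `|phi s|) @^-1` [set x | r <= x].
      by apply/seteqP; split => s /=; rewrite in_itv.
    apply: compact_closedI; first exact: segment_compact.
    by apply: closed_comp; [move=> s _; exact: cphi|exact: closed_ge].
  have [|||c /set_mem[cT rc] cmin] := @compact_EVT_min R R id A.
  - by exists t.
  - exact: cA.
  - by apply: continuous_subspaceT => s; exact: cvg_id.
  (* c is the first time at which phi leaves the open cube of radius r. *)
  have below s : 0 <= s < c -> `|phi s| <= r.
    move=> /andP[s0 sc]; rewrite leNgt; apply/negP => rs.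
    have /cmin : s \in A.
      by apply/mem_set; split; [move/andP: cT => [_ cT]; rewrite s0 (le_trans (ltW sc))|exact: ltW].
    by rewrite leNgt sc.
  have xr : `|x0| < r by rewrite /r -addrA ltrDl ltr_wpDl.
  have c0 : 0 < c.
    have /andP[c0 _] := cT; rewrite lt_neqAle c0 andbT; apply/negP => /eqP c0'.
    by move: rc; rewrite -c0' phi0 leNgt xr.
  have le_c : `|phi c| <= r.
    rewrite leNgt; apply/negP => rc'.
    have h : \forall s \near c, r < `|phi s| by exact: (cvgr_gt _ (cphi c)).
    have hl : \forall s \near c^'-, r < `|phi s| by exact: cvg_at_left_filter h.
    have : \forall s \near c^'-, False.
      near=> s; have : r < `|phi s| by near: s.
      rewrite ltNge below //; apply/andP; split; last by [].
      by near: s; exact: nbhs_left_ge.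
    by move/filter_ex => -[].
  have : `|phi c| <= rho.
    apply: apriori => // s /andP[s0 sc]; apply: dphiF.
    by move: sc; rewrite le_eqVlt => /predU1P[->//|sc]; apply: below; rewrite s0.
  move: rc; have := ler_norm rho; have := normr_ge0 x0; rewrite /r; lra.
have margin s : 0 <= s <= T -> exists2 d : R, 0 < d & forall t, `|s - t| < d -> `|phi t| <= r.
  move=> /inside h.
  have /nbhs_ballP[d d0 hd] : \forall t \near s, `|phi t| < r.
    exact: (cvgr_lt _ (cphi s)).
  by exists d => // t st; apply/ltW/hd; rewrite -ball_normE.
have [|d d0 hd] := margin 0; first by rewrite lexx.
have [|d' d'0 hd'] := margin T; first by rewrite lexx T0.
exists (Num.min d d'); first by rewrite lt_min d0.
exists phi; split=> // t /andP[]; rewrite ltrNl => h1; rewrite -ltrBlDl => h2.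
apply: dphiF; have [t0|t0] := ltP t 0.
  apply: hd; rewrite sub0r normrN ltr0_norm //.
  by apply: lt_le_trans h1 _; rewrite ge_min lexx.
have [tT|tT] := leP t T; first by apply/ltW/inside; rewrite t0.
apply: hd'; rewrite distrC gtr0_norm ?subr_gt0 //.
by apply: lt_le_trans h2 _; rewrite ge_min lexx orbT.
Unshelve. all: by end_near. Qed.

Lemma time_interval_itv (a b : R) : a < 0 -> 0 < b -> time_interval `]a, b[%classic.
Proof.
move=> a0 b0; split; first exact: interval_is_interval.
  exact: interval_open.
by rewrite /= in_itv /= a0.
Qed.

(** The interval is the union of the intervals of all solutions; uniqueness makes
    their values agree on overlaps. *)
Lemma maximal_solution N m (F : 'cV[R]_N -> 'cV[R]_m -> 'cV[R]_N) x u :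
  locally_lipschitz (F^~ u) ->
  (exists J psi, time_interval J /\ is_solution F x u J psi) ->
  exists (I : set R) (phi : R -> 'cV[R]_N),
    [/\ is_maximal_solution F x u I phi,
        is_unique_solution F x u I phi &
        forall J psi, time_interval J -> is_solution F x u J psi -> J `<=` I /\
          forall t, J t -> phi t = psi t].
Proof.
move=> lF [J0 [psi0 [tJ0 sJ0]]].
pose I := [set t : R | exists J psi, [/\ time_interval J, is_solution F x u J psi & J t]].
have agree J J' psi psi' t : time_interval J -> time_interval J' ->
    is_solution F x u J psi -> is_solution F x u J' psi' ->
    J t -> J' t -> psi t = psi' t.
  move=> [iJ _ J_0] [iJ' _ J'_0] [p0 dp] [p'0 dp'] Jt J't.
  apply: (@solution_unique _ _ (F^~ u) psi psi' (J `&` J')) => //.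
  - by move=> a b [Ja J'a] [Jb J'b] z zab; split; [exact: iJ zab|exact: iJ' zab].
  - by rewrite p0 p'0.
  - by move=> s [/dp].
  - by move=> s [_ /dp'].
have /choice[phi hphi] t : exists v, forall J psi, time_interval J ->
    is_solution F x u J psi -> J t -> v = psi t.
  have [[J [psi [tJ sJ Jt]]]|nI] := pselect (I t).
    by exists (psi t) => J' psi' tJ' sJ' J't; exact: (agree J J').
  by exists 0 => J psi tJ sJ Jt; case: nI; exists J, psi.
have sub J psi : time_interval J -> is_solution F x u J psi -> J `<=` I.
  by move=> tJ sJ t Jt; exists J, psi.
have I0 : I 0 by exists J0, psi0; split=> //; case: tJ0.
have tI : time_interval I.
  split=> //.
    move=> a b [J [psi [tJ sJ Ja]]] [J' [psi' [tJ' sJ' J'b]]] z /andP[az zb].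
    have [z0|/ltW z0] := leP 0 z.
      exists J', psi'; split=> //; have [iJ' _ J'0] := tJ'.
      by apply: (iJ' 0 b) => //; rewrite z0.
    exists J, psi; split=> //; have [iJ _ J_0] := tJ.
    by apply: (iJ a 0) => //; rewrite az.
  rewrite openE => t [J [psi [tJ sJ Jt]]].
  have [_ oJ _] := tJ.
  by apply: filterS (open_nbhs_nbhs (conj oJ Jt)); exact: sub sJ.
have sI : is_solution F x u I phi.
  split.
    by rewrite (hphi 0 J0 psi0) //; [case: sJ0|case: tJ0].
  move=> t [J [psi [tJ sJ Jt]]].
  rewrite (hphi t J psi) //; have [_ oJ _] := tJ.
  apply: (@near_eq_is_derive _ _ _ psi); last by case: sJ => _; apply.
  by apply: filterS (open_nbhs_nbhs (conj oJ Jt)) => s Js; rewrite (hphi s J psi).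
exists I, phi; split.
- split=> // J psi tJ sJ IJ _.
  by apply/seteqP; split=> //; exact: sub sJ.
- by split=> // psi spsi t It; rewrite (hphi t I psi).
- by move=> J psi tJ sJ; split=> [|t Jt]; [exact: sub sJ|exact: hphi sJ Jt].
Qed.

End Continuation.

(** * The robotic system *)

Section RobotDynamics.
Context {R : realType}.

Lemma pos_def_unitmx n (M : 'M[R]_n) : pos_def M -> M \in unitmx.
Proof.
move=> [_ pM]; rewrite unitmxE unitfE; apply/negP => /det0P[v v0 vM].
have vT0 : v^T != 0.
  by apply: contra_neq v0 => vT0; rewrite -[v]trmxK vT0 trmx0.
by have := pM v^T vT0; rewrite /quad_form trmxK vM mul0mx mxE ltxx.
Qed.

Lemma quad_formE n (M : 'M[R]_n) (v : 'cV[R]_n) :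
  quad_form M v = \sum_i \sum_j v i 0 * M i j * v j 0.
Proof.
rewrite /quad_form mxE exchange_big /=; apply: eq_bigr => j _.
by rewrite mxE mulr_suml; apply: eq_bigr => i _; rewrite mxE.
Qed.

Lemma norm2_sqr n (v : 'cV[R]_n) : norm2 v ^+ 2 = \sum_i v i 0 ^+ 2.
Proof. by rewrite /norm2 sqr_sqrtr //; apply: sumr_ge0 => i _; exact: sqr_ge0. Qed.

Lemma quad_form_ge n (M : 'M[R]_n) (l : R) (v : 'cV[R]_n) :
  loewner_le l%:M M -> l * norm2 v ^+ 2 <= quad_form M v.
Proof.
move=> [_ /(_ v)]; rewrite /quad_form mulmxBr mulmxBl mxE [X in _ + X]mxE subr_ge0.
move=> h; apply: le_trans h; rewrite mul_mx_scalar -scalemxAl mxE norm2_sqr.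
rewrite mxE le_eqVlt; apply/orP; left; apply/eqP; congr (_ * _).
by apply: eq_bigr => i _; rewrite mxE expr2.
Qed.

Lemma is_derive_partial n (f : 'cV[R]_n -> R) (q : R -> 'cV[R]_n) (t : R) dq :
  differentiable f (q t) -> is_derive t (1 : R) q dq ->
  is_derive t (1 : R) (fun s => f (q s)) (\sum_k partial k f (q t) * dq k 0).
Proof.
move=> df [/derivable1_diffP diffq qE].
have d : differentiable (f \o q) t by exact: differentiable_comp.
split; first exact/derivable1_diffP.
have {}qE : 'd q t 1 = dq by rewrite -deriveE.
rewrite deriveE // diff_comp //= qE.
rewrite {1}(matrix_sum_delta dq) linear_sum; apply: eq_bigr => k _.
rewrite big_ord_recl big_ord0 addr0 linearZ /= /partial deriveE //.
by rewrite /GRing.scale /= mulrC; congr (_ * _); rewrite (_ : ord0 = 0).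
Qed.

Section Energy.
Context {n : nat} (D : 'cV[R]_n -> 'M[R]_n).

(** Renaming summation indices, the two terms of the Coriolis matrix contribute
    1 and -1/2 times the same cubic form in the velocity. *)
Lemma coriolis_power (q v : 'cV[R]_n) :
  \sum_i v i 0 * (coriolis D q v *m v) i 0 =
  2^-1 * \sum_i \sum_j v i 0 * (\sum_k partial k (fun p => D p i j) q * v k 0) * v j 0.
Proof.
pose S i j k := partial k (fun p => D p i j) q * v i 0 * v j 0 * v k 0.
have -> : \sum_i \sum_j v i 0 * (\sum_k partial k (fun p => D p i j) q * v k 0) * v j 0 =
    \sum_i \sum_j \sum_k S i j k.
  apply: eq_bigr => i _; apply: eq_bigr => j _.
  rewrite mulr_sumr mulr_suml; apply: eq_bigr => k _.
  by rewrite /S; ring.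
have -> : \sum_i v i 0 * (coriolis D q v *m v) i 0 =
    \sum_i \sum_j \sum_k (S i k j - 2^-1 * S j k i).
  apply: eq_bigr => i _; rewrite mxE mulr_sumr; apply: eq_bigr => j _.
  rewrite mxE mulr_suml mulr_sumr; apply: eq_bigr => k _.
  by rewrite /S; ring.
have -> : \sum_i \sum_j \sum_k (S i k j - 2^-1 * S j k i) =
    \sum_i \sum_j \sum_k S i k j - 2^-1 * \sum_i \sum_j \sum_k S j k i.
  rewrite mulr_sumr -sumrB; apply: eq_bigr => i _.
  rewrite mulr_sumr -sumrB; apply: eq_bigr => j _.
  by rewrite mulr_sumr -sumrB; apply: eq_bigr.
have -> : \sum_i \sum_j \sum_k S i k j = \sum_i \sum_j \sum_k S i j k.
  by apply: eq_bigr => i _; rewrite exchange_big.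
have -> : \sum_i \sum_j \sum_k S j k i = \sum_i \sum_j \sum_k S i j k.
  rewrite exchange_big /=; apply: eq_bigr => i _.
  by rewrite exchange_big.
by field.
Qed.

(** The Coriolis forces do no net work: by [coriolis_power] their contribution
    cancels the derivative of D along the motion. *)
Lemma kinetic_energy_derive (q v : R -> 'cV[R]_n) (W : 'cV[R]_n) (t : R) :
  (forall q, pos_def (D q)) -> (forall q, differentiable D q) ->
  is_derive t (1 : R) q (v t) ->
  is_derive t (1 : R) v
    (invmx (D (q t)) *m (W - coriolis D (q t) (v t) *m v t)) ->
  is_derive t (1 : R) (fun s => quad_form (D (q s)) (v s))
    (2 * \sum_i v t i 0 * W i 0).
Proof.
move=> pD dD dq; set a := invmx _ *m _ => dv.
have Da : D (q t) *m a = W - coriolis D (q t) (v t) *m v t.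
  by rewrite /a mulKVmx // pos_def_unitmx.
have dvi i : is_derive t (1 : R) (fun s => v s i 0) (a i 0).
  exact: (is_derive_mxP _ _ _).1.
have dDij i j : is_derive t (1 : R) (fun s => D (q s) i j)
    (\sum_k partial k (fun p => D p i j) (q t) * v t k 0).
  apply: (@is_derive_partial _ (fun p => D p i j)) => //.
  exact: (differentiable_comp (dD _) (differentiable_coord _ _ _)).
set dDv := fun i j => \sum_k partial k (fun p => D p i j) (q t) * v t k 0 in dDij *.
have dE : is_derive t (1 : R) (fun s => \sum_i \sum_j v s i 0 * D (q s) i j * v s j 0)
    (\sum_i \sum_j ((a i 0 * D (q t) i j + v t i 0 * dDv i j) * v t j 0 +
      v t i 0 * D (q t) i j * a j 0)).
  apply: is_derive_bigsum => i; apply: is_derive_bigsum => j.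
  by apply: is_derive_mul => //; exact: is_derive_mul.
under eq_fun do rewrite quad_formE.
apply: is_derive_eq dE _.
have -> : \sum_i \sum_j ((a i 0 * D (q t) i j + v t i 0 * dDv i j) * v t j 0 +
      v t i 0 * D (q t) i j * a j 0) =
   \sum_i \sum_j a i 0 * D (q t) i j * v t j 0 +
   \sum_i \sum_j v t i 0 * dDv i j * v t j 0 +
   \sum_i \sum_j v t i 0 * D (q t) i j * a j 0.
  rewrite -!big_split /=; apply: eq_bigr => i _.
  rewrite -!big_split /=; apply: eq_bigr => j _; ring.
have DaE : \sum_i \sum_j v t i 0 * D (q t) i j * a j 0 =
    \sum_i v t i 0 * W i 0 - \sum_i v t i 0 * (coriolis D (q t) (v t) *m v t) i 0.
  rewrite -sumrB; apply: eq_bigr => i _.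
  have := congr1 (fun M : 'cV[R]_n => M i 0) Da; rewrite mxE [RHS]mxE [X in _ + X]mxE.
  rewrite -mulrBr => <-; rewrite mulr_sumr.
  by apply: eq_bigr => j _; rewrite mulrA.
have -> : \sum_i \sum_j a i 0 * D (q t) i j * v t j 0 =
    \sum_i \sum_j v t i 0 * D (q t) i j * a j 0.
  rewrite exchange_big /=; apply: eq_bigr => i _; apply: eq_bigr => j _.
  have [sD _] := pD (q t).
  have -> : D (q t) j i = D (q t) i j by rewrite -[in LHS]sD mxE.
  ring.
rewrite DaE coriolis_power -/dDv.
set Q := \sum_i \sum_j v t i 0 * dDv i j * v t j 0.
by field.
Qed.

End Energy.

Lemma ler_norm_speed n (q v : R -> 'cV[R]_n) (V s : R) : 0 <= s ->
  (forall t, 0 <= t <= s -> is_derive t (1 : R) q (v t)) ->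
  (forall t, 0 <= t <= s -> `|v t| <= V) ->
  `|q s| <= `|q 0| + V * s.
Proof.
move=> s0 dq vV.
have V0 : 0 <= V by apply: le_trans (vV 0 _); rewrite ?lexx ?s0.
apply/mx_norm_leP => [|i j]; first by rewrite addr_ge0 // mulr_ge0.
have q0 : `|q 0 i j| <= `|q 0| := ler_mx_norm_coord _ _ _.
have dqi t : 0 <= t <= s -> is_derive t (1 : R) (fun r => q r i j) (v t i j).
  by move=> /dq; move/is_derive_mxP.
have vi t : 0 <= t <= s -> `|v t i j| <= V.
  by move=> /vV; exact: le_trans (ler_mx_norm_coord _ _ _).
have dV t : is_derive t (1 : R) (fun r => V * r) V.
  have := is_deriveZ V (is_derive_id t (1 : R)).
  by move/is_derive_eq; apply; rewrite /GRing.scale /= mulr1.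
have up : V * 0 - q 0 i j <= V * s - q s i j.
  apply: (@is_derive_nonneg_le _ (fun r => V * r - q r i j) (fun r => V - v r i j)) => // t ts.
    exact: is_deriveB (dV t) (dqi t ts).
  by rewrite subr_ge0; apply: le_trans (vi t ts); exact: ler_norm.
have lo : V * 0 + q 0 i j <= V * s + q s i j.
  apply: (@is_derive_nonneg_le _ (fun r => V * r + q r i j) (fun r => V + v r i j)) => // t ts.
    exact: is_deriveD (dV t) (dqi t ts).
  by have := vi t ts; rewrite ler_norml => /andP[+ _]; lra.
move: up lo q0; rewrite mulr0 !ler_norml => up lo /andP[q1 q2].
by apply/andP; split; lra.
Qed.

Section RobotMap.
Context {n m : nat} (D : 'cV[R]_n -> 'M[R]_n) (U : 'cV[R]_n -> R)
  (Fext : 'cV[R]_n -> 'cV[R]_n -> 'cV[R]_n) (B : 'cV[R]_n -> 'M[R]_(n, m)).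
Hypothesis D_pos_def : forall q, pos_def (D q).
Hypothesis D_lipschitz : locally_lipschitz D.
Hypothesis coriolis_lipschitz : locally_lipschitz
  (fun p : 'cV[R]_n * 'cV[R]_n => coriolis D p.1 p.2).
Hypothesis gradU_lipschitz : locally_lipschitz (gradient U).
Hypothesis Fext_lipschitz : locally_lipschitz
  (fun p : 'cV[R]_n * 'cV[R]_n => Fext p.1 p.2).
Hypothesis B_lipschitz : locally_lipschitz B.

Let locally_lipschitz_config (W : normedModType R) (f : 'cV[R]_n -> W) :
  locally_lipschitz f -> locally_lipschitz (fun x : 'cV[R]_(n + n) => f (usubmx x)).
Proof. by move=> lf; exact: (locally_lipschitz_comp lf (@locally_lipschitz_usubmx _ n n)). Qed.

Let locally_lipschitz_state (W : normedModType R) (f : 'cV[R]_n -> 'cV[R]_n -> W) :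
  locally_lipschitz (fun p : 'cV[R]_n * 'cV[R]_n => f p.1 p.2) ->
  locally_lipschitz (fun x : 'cV[R]_(n + n) => f (usubmx x) (dsubmx x)).
Proof.
move=> lf; apply: (@locally_lipschitz_comp _ _ _ _
  (fun x : 'cV[R]_(n + n) => (usubmx x, dsubmx x)) _ lf).
exact: locally_lipschitz_pair (@locally_lipschitz_usubmx _ n n) (@locally_lipschitz_dsubmx _ n n).
Qed.

Let locally_lipschitz_invD :
  locally_lipschitz (fun x : 'cV[R]_(n + n) => invmx (D (usubmx x))).
Proof.
apply: locally_lipschitz_invmx => [x|]; first exact: pos_def_unitmx.
exact: locally_lipschitz_config.
Qed.

Lemma control_matrix_lipschitz : locally_lipschitz (control_matrix D B).
Proof.
apply: locally_lipschitz_col_mx; first exact: locally_lipschitz_cst.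
by apply: locally_lipschitz_mulmx => //; exact: locally_lipschitz_config.
Qed.

Lemma robot_map_lipschitz (u : 'cV[R]_m) :
  locally_lipschitz (fun x => robot_map D U Fext B x u).
Proof.
apply: locally_lipschitzD; last first.
  by apply: locally_lipschitz_mulmx; [exact: control_matrix_lipschitz|exact: locally_lipschitz_cst].
apply: locally_lipschitz_col_mx; first exact: locally_lipschitz_dsubmx.
apply: locally_lipschitz_mulmx => //.
apply: locally_lipschitzD; last exact/locally_lipschitzN/locally_lipschitz_config.
apply: locally_lipschitzD; first exact: locally_lipschitz_state.
apply: locally_lipschitzN; apply: locally_lipschitz_mulmx.
  exact: locally_lipschitz_state.
exact: locally_lipschitz_dsubmx.
Qed.

(** Grouping the input with the forces, as in the growth hypothesis, leaves only
    the Coriolis term apart. *)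
Lemma robot_mapE x u : robot_map D U Fext B x u =
  let q := usubmx x in let v := dsubmx x in
  col_mx v (invmx (D q) *m
    ((Fext q v - gradient U q + B q *m u) - coriolis D q v *m v)).
Proof.
rewrite /robot_map /drift_field /control_matrix /= mul_col_mx mul0mx add_col_mx addr0.
congr col_mx; rewrite -mulmxA -mulmxDr; congr (_ *m _).
by rewrite -!addrA; congr (_ + _); rewrite addrC -addrA.
Qed.

Hypothesis D_differentiable : forall q, differentiable D q.
Variable lambda_min : R.
Hypothesis lambda_min_gt0 : 0 < lambda_min.
Hypothesis D_ge : forall q, loewner_le lambda_min%:M (D q).

(** From 2 v . W <= |v|^2 + |W|^2 with |W| <= c0 + c1 |v|, where v is the
    velocity and W the total force other than the Coriolis term, the energy
    satisfies E' <= 2 c0^2 + (1 + 2 c1^2) |v|^2, and |v|^2 <= E / lambda_min. *)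
Lemma robot_apriori_bound (x : 'cV[R]_(n + n)) (u : 'cV[R]_m) (c0 c1 T : R) :
  0 <= T ->
  (forall q qdot : 'cV[R]_n,
    norm2 (Fext q qdot - gradient U q + B q *m u) <= c0 + c1 * norm2 qdot) ->
  exists rho : R, forall s psi, 0 <= s <= T -> psi 0 = x ->
    (forall t, 0 <= t <= s ->
      is_derive t (1 : R) psi (robot_map D U Fext B (psi t) u)) ->
    `|psi s| <= rho.
Proof.
move=> T0 growth.
pose E0 := quad_form (D (usubmx x)) (dsubmx x).
pose a := 2 * c0 ^+ 2; pose b := (1 + 2 * c1 ^+ 2) / lambda_min.
have a0 : 0 <= a by rewrite mulr_ge0 // sqr_ge0.
have c10 : 0 < 1 + 2 * c1 ^+ 2 by rewrite ltr_wpDr // mulr_ge0 // sqr_ge0.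
have b0 : 0 < b by rewrite divr_gt0.
have Ege q v : lambda_min * norm2 v ^+ 2 <= quad_form (D q) v by exact: quad_form_ge.
have E_ge0 q v : 0 <= quad_form (D q) v.
  by apply: le_trans (Ege q v); rewrite mulr_ge0 ?sqr_ge0 // ltW.
(* Gronwall at time T bounds the energy, and lambda_min |v|^2 <= E the speed. *)
pose V := Num.sqrt ((E0 + a / b) * expR (b * T) / lambda_min).
have V0 : 0 <= V by exact: sqrtr_ge0.
exists (`|x| + V * T + V) => s psi /andP[s0 sT] psi0 dpsi.
pose q t : 'cV[R]_n := usubmx (psi t); pose v t : 'cV[R]_n := dsubmx (psi t).
pose W t := Fext (q t) (v t) - gradient U (q t) + B (q t) *m u.
have dq t : 0 <= t <= s -> is_derive t (1 : R) q (v t).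
  move=> /dpsi; rewrite robot_mapE /= => /is_derive_mxP h.
  apply/is_derive_mxP => i j; have := h (lshift n i) j.
  by rewrite col_mxEu; congr (is_derive _ _ _ _); apply/funext => r; rewrite !mxE.
have dv t : 0 <= t <= s -> is_derive t (1 : R) v
    (invmx (D (q t)) *m (W t - coriolis D (q t) (v t) *m v t)).
  move=> /dpsi; rewrite robot_mapE /= => /is_derive_mxP h.
  apply/is_derive_mxP => i j; have := h (rshift n i) j.
  by rewrite col_mxEd; congr (is_derive _ _ _ _); apply/funext => r; rewrite !mxE.
pose E t := quad_form (D (q t)) (v t).
have dE t : 0 <= t <= s -> is_derive t (1 : R) E (2 * \sum_i v t i 0 * W t i 0).
  by move=> ts; apply: kinetic_energy_derive => //; [exact: dq|exact: dv].
have dEle t : 0 <= t <= s -> 2 * \sum_i v t i 0 * W t i 0 <= a + b * E t.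
  move=> ts; have vW : 2 * \sum_i v t i 0 * W t i 0 <= norm2 (v t) ^+ 2 + norm2 (W t) ^+ 2.
    rewrite !norm2_sqr mulr_sumr -big_split /=; apply: ler_sum => i _.
    by have := sqr_ge0 (v t i 0 - W t i 0); rewrite sqrrB; lra.
  apply: le_trans vW _.
  have W2 : norm2 (W t) ^+ 2 <= 2 * c0 ^+ 2 + 2 * c1 ^+ 2 * norm2 (v t) ^+ 2.
    apply: (@le_trans _ _ ((c0 + c1 * norm2 (v t)) ^+ 2)).
      have W0 : 0 <= norm2 (W t) by exact: sqrtr_ge0.
      by rewrite !expr2; apply: ler_pM => //; exact: growth.
    have := sqr_ge0 (c0 - c1 * norm2 (v t)).
    by rewrite sqrrB sqrrD exprMn; lra.
  have v2 : (1 + 2 * c1 ^+ 2) * norm2 (v t) ^+ 2 <= b * E t.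
    rewrite /b -mulrA ler_pM2l // ler_pdivlMl //; exact: Ege.
  by rewrite /a; lra.
have v_le t : 0 <= t <= s -> `|v t| <= V.
  move=> /andP[t0 ts].
  have EtE : E t <= (E0 + a / b) * expR (b * T).
    have sub r : 0 <= r <= t -> 0 <= r <= s.
      by move=> /andP[r0 rt]; rewrite r0 (le_trans rt).
    have := @gronwall _ E _ a b t b0 t0 (fun r rt => dE r (sub r rt)) (fun r rt => dEle r (sub r rt)).
    have -> : E 0 = E0 by rewrite /E /q /v psi0.
    move=> h; apply: (le_trans h).
    have ab0 : 0 <= a / b by rewrite divr_ge0 // ltW.
    apply: (@le_trans _ _ ((E0 + a / b) * expR (b * t))); first by rewrite gerBl.
    rewrite ler_wpM2l ?addr_ge0 //; first exact: E_ge0.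
    by rewrite ler_expR ler_pM2l // (le_trans ts).
  apply/mx_norm_leP => // i j; rewrite ord1 -sqrtr_sqr ler_wsqrtr //.
  apply: (@le_trans _ _ (norm2 (v t) ^+ 2)).
    rewrite norm2_sqr (bigD1 i) //= lerDl.
    by apply: sumr_ge0 => k _; exact: sqr_ge0.
  by rewrite ler_pdivlMr // mulrC (le_trans _ EtE) //; exact: Ege.
have q_le : `|q s| <= `|x| + V * T.
  have := ler_norm_speed s0 dq v_le.
  have : `|q 0| <= `|x|.
    rewrite /q psi0; apply/mx_norm_leP => // i j; rewrite mxE.
    exact: ler_mx_norm_coord.
  have : V * s <= V * T by rewrite ler_wpM2l.
  lra.
have vs : `|v s| <= V by apply: v_le; rewrite s0 lexx.
have psi_s : psi s = col_mx (q s) (v s) by rewrite vsubmxK.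
apply/mx_norm_leP => [|i j].
  by rewrite !addr_ge0 // mulr_ge0.
rewrite psi_s mxE; case: fintype.split => k.
  apply: le_trans (ler_mx_norm_coord _ _ _) _.
  by apply: le_trans q_le _; rewrite lerDl.
apply: le_trans (ler_mx_norm_coord _ _ _) _.
by apply: le_trans vs _; rewrite lerDr addr_ge0 // mulr_ge0.
Qed.

Lemma robot_complete (x : 'cV[R]_(n + n)) (u : 'cV[R]_m) (c0 c1 : R) :
  (forall q qdot : 'cV[R]_n,
    norm2 (Fext q qdot - gradient U q + B q *m u) <= c0 + c1 * norm2 qdot) ->
  exists (I : set R) (phi : R -> 'cV[R]_(n + n)),
    let F := robot_map D U Fext B in
    [/\ is_maximal_solution F x u I phi,
        is_unique_solution F x u I phi,
        forall J psi, is_maximal_solution F x u J psi ->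
            J = I /\ (forall t, I t -> psi t = phi t)
      & forall t, 0 <= t -> I t].
Proof.
move=> growth; set F := robot_map D U Fext B.
have lF : locally_lipschitz (F^~ u) by exact: robot_map_lipschitz.
have upto T : 0 <= T -> exists J psi,
    [/\ time_interval J, is_solution F x u J psi & J T].
  move=> T0; have [rho hrho] := robot_apriori_bound x T0 growth.
  have [e e0 [psi [psi0 dpsi]]] := bounded_solution_exists lF T0 hrho.
  exists `]- e, T + e[%classic, psi; split.
  - by apply: time_interval_itv; rewrite ?oppr_lt0 // ltr_wpDl.
  - by split=> // t /=; rewrite in_itv; exact: dpsi.
  - by rewrite /= in_itv /= ltrDl e0 andbT (lt_le_trans _ T0) // oppr_lt0.
have [J0 [psi0 [tJ0 sJ0 _]]] := upto 0 (lexx 0).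
have [|I [phi [maxI uniI subI]]] := @maximal_solution _ _ _ F x u lF.
  by exists J0, psi0.
exists I, phi; split=> //.
  move=> J psi [tJ sJ maxJ]; have [JI phipsi] := subI J psi tJ sJ.
  have [tI sI _] := maxI.
  have IJ := maxJ I phi tI sI JI phipsi.
  by rewrite -IJ in phipsi *; split=> // t It; rewrite phipsi.
move=> t t0; have [J [psi [tJ sJ Jt]]] := upto t t0.
by have [JI _] := subI J psi tJ sJ; exact: JI.
Qed.

End RobotMap.
End RobotDynamics.

Theorem mainTheorem3 (R : realType) (n m : nat)
    (D : 'cV[R]_n -> 'M[R]_n) (U : 'cV[R]_n -> R)
    (Fext : 'cV[R]_n -> 'cV[R]_n -> 'cV[R]_n)
    (B : 'cV[R]_n -> 'M[R]_(n, m))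
    (D_pos_def : forall q, pos_def (D q))
    (D_differentiable : forall q, differentiable D q)
    (U_differentiable : forall q, differentiable U q)
    (D_lipschitz : locally_lipschitz D)
    (coriolis_lipschitz : locally_lipschitz
      (fun p : 'cV[R]_n * 'cV[R]_n => coriolis D p.1 p.2))
    (gradU_lipschitz : locally_lipschitz (gradient U))
    (Fext_lipschitz : locally_lipschitz
      (fun p : 'cV[R]_n * 'cV[R]_n => Fext p.1 p.2))
    (B_lipschitz : locally_lipschitz B)
    (lambda_min : R) (lambda_min_gt0 : 0 < lambda_min)
    (D_ge : forall q, loewner_le (lambda_min%:M) (D q))
    (G : set 'cV[R]_m) (G_nonempty : G !=set0) (G_closed : closed G)
    (G_growth : forall u, G u ->
      exists c0 c1 : R, [/\ 0 <= c0, 0 < c1 &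
        forall q qdot : 'cV[R]_n,
          norm2 (Fext q qdot - gradient U q + B q *m u)
            <= c0 + c1 * norm2 qdot]) :
  let F := robot_map D U Fext B in
  (forall (x : 'cV[R]_(n + n)) (u : 'cV[R]_m), G u ->
    exists (I : set R) (phi : R -> 'cV[R]_(n + n)),
      [/\ is_maximal_solution F x u I phi,
          forall J psi, is_maximal_solution F x u J psi ->
            J = I /\ (forall t, I t -> psi t = phi t)
        & forall t, 0 <= t -> I t]) /\
  (forall h : R, 0 < h ->
    [/\ locally_lipschitz (fun x => F x 0),
        forall j : 'I_m,
          locally_lipschitz (fun x => col j (control_matrix D B x))
      & exists (S : set 'cV[R]_(n + n)) (A : set 'cV[R]_m)
               (C : 'cV[R]_(n + n) -> set 'cV[R]_m),
          [/\ S !=set0 /\ S `<=` sampling_states F h,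
              A !=set0 /\ (forall x, S x -> C x `<=` A),
              forall x, S x -> C x !=set0 /\ C x `<=` sampling_inputs F h x,
              closed (graph S C : set (subspace (S `*` A)))
            & [set sampled_map F h p.1 p.2 | p in graph S C] `<=` S]]).
Proof.
move=> F.
have complete x u : G u -> exists (I : set R) (phi : R -> 'cV[R]_(n + n)),
    [/\ is_maximal_solution F x u I phi,
        is_unique_solution F x u I phi,
        forall J psi, is_maximal_solution F x u J psi ->
            J = I /\ (forall t, I t -> psi t = phi t)
      & forall t, 0 <= t -> I t].
  move=> /G_growth[c0 [c1 [_ _ growth]]].
  exact: (robot_complete D_pos_def D_lipschitz coriolis_lipschitz gradU_lipschitz
    Fext_lipschitz B_lipschitz D_differentiable lambda_min_gt0 D_ge x growth).
split.
  move=> x u /(complete x)[I [phi [maxI _ uniqI posI]]].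
  by exists I, phi.
move=> h h0.
have sampled x u : G u -> sampling_inputs F h x u.
  move=> /(complete x)[I [phi [[tI _ _] uniI _ posI]]].
  exists phi, I; split=> // t /=; rewrite in_itv /= => /andP[t0 _].
  exact: posI.
split.
- exact: robot_map_lipschitz.
- have /locally_lipschitz_mxP lC := control_matrix_lipschitz D_pos_def D_lipschitz B_lipschitz.
  move=> j; apply/locally_lipschitz_mxP => i k.
  by under eq_fun do rewrite mxE; exact: lC.
have [u0 Gu0] := G_nonempty.
exists setT, G, (fun=> G); split.
- by split; [exists 0|move=> x _; exists u0; exact: sampled].
- by split=> [|x _]; [exists u0|].
- by move=> x _; split; [exists u0|move=> u; exact: sampled].
- rewrite (_ : graph _ _ = setT `*` G); first exact: closed_subspaceT.
  by apply/seteqP; split.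
- by move=> ? _.
Qed.
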